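(* Let $L,R\subset\mathbb{P}^3$ be two lines such that $W=L\star R$ is a quadratic surface. Then $W$ is smooth and it is tangent to all four coordinate planes $H_i=\{x_i=0\}$, $i=0,1,2,3$.
   Context: Work over $\mathbb{C}$ with fixed homogeneous coordinates $x_0,\dots,x_3$ on $\mathbb{P}^3$. For points $p=(p_0:\cdots:p_3)$ and $q=(q_0:\cdots:q_3)$ the Hadamard product is $p\star q=(p_0q_0:\cdots:p_3q_3)$, defined whenever not all $p_iq_i$ vanish. For varieties $X,Y\subset\mathbb{P}^3$, $X\star Y$ is the Zariski closure of $\{p\star q : p\in X,\ q\in Y,\ p\star q \text{ is defined}\}$. A quadratic surface is a surface of degree $2$ in $\mathbb{P}^3$. A smooth surface $W$ is tangent to a plane $H$ if $H$ is the tangent plane of $W$ at some point of $W\cap H$ (equivalently, for a smooth quadric, the conic $W\cap H$ is singular). *)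

(* Defs.v *)
From HB Require Import structures.
From mathcomp Require Import all_boot all_order all_algebra.
From mathcomp Require Import classical_sets reals complex mpoly.

Set Implicit Arguments.
Unset Strict Implicit.
Unset Printing Implicit Defensive.

Import GRing.Theory.

Local Open Scope ring_scope.
Local Open Scope classical_set_scope.

(* A point of P^n over F is a line through the origin of F^(n+1). *)
Record proj (F : fieldType) (n : nat) := Proj {
  proj_line :> {vspace 'rV[F]_n.+1};
  proj_lineP : \dim proj_line == 1%N
}.

HB.instance Definition _ (F : fieldType) (n : nat) :=
  [isSub for @proj_line F n].
HB.instance Definition _ (F : fieldType) (n : nat) :=
  [Choice of proj F n by <:].

Section ProjectiveSpace.
Context {F : fieldType} {n : nat}.
Implicit Types (p q r : proj F n) (X Y Z : set (proj F n)).
Implicit Types (v w : 'rV[F]_n.+1) (f g : {mpoly F[n.+1]}).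

(* p = (v_0 : ... : v_n) *)
Definition coordinates p v := v != 0 /\ v \in (p : {vspace _}).

(* For f homogeneous this does not depend on the chosen coordinates of p. *)
Definition vanishes_at f p := forall v, coordinates p v -> f.@[v 0] = 0.

(* The form f of degree d belongs to the homogeneous ideal I(X). *)
Definition form_vanishing_on X (d : nat) f :=
  f \is d.-homog /\ forall p, X p -> vanishes_at f p.

Definition zariski_closed Z :=
  exists S : set {mpoly F[n.+1]},
    (forall f, S f -> exists d : nat, f \is d.-homog) /\
    Z = [set p | forall f, S f -> vanishes_at f p].

Definition zariski_closure X : set (proj F n) := smallest zariski_closed X.

Definition hadamard v w : 'rV[F]_n.+1 := \row_i (v 0 i * w 0 i).

(* The point p * q is defined and equal to r; [coordinates r] forces the
   Hadamard product of the coordinates to be nonzero. *)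
Definition hadamard_point p q r :=
  exists v w, [/\ coordinates p v, coordinates q w
                & coordinates r (hadamard v w)].

Definition hadamard_product X Y : set (proj F n) :=
  zariski_closure
    [set r | exists p q, [/\ X p, Y q & hadamard_point p q r]].

(* X is a linear subspace of projective dimension d. *)
Definition linear_subspace (d : nat) X :=
  exists U : {vspace 'rV[F]_n.+1},
    \dim U = d.+1 /\ X = [set p | (p <= U)%VS].

Definition coord_hyperplane (i : 'I_n.+1) : set (proj F n) :=
  [set p | forall v, coordinates p v -> v 0 i = 0].

(* X is a hypersurface of degree d: its homogeneous ideal I(X) is generated by
   one nonzero form of degree d (the degree is that of the reduced equation, so
   that a plane is not a surface of degree 2 with equation l^2 = 0). *)
Definition hypersurface_of_degree (d : nat) X :=
  zariski_closed X /\
  exists g, [/\ g != 0, g \is d.-homog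
    & forall e f, f \is e.-homog ->
        (form_vanishing_on X e f <-> exists h, f = h * g)].

(* The embedded projective tangent space of X at p, i.e. the zero locus of the
   linear forms sum_i (df/dx_i)(p) x_i for all forms f in I(X). *)
Definition tangent_space X p : set (proj F n) :=
  [set q | forall (d : nat) f v w, form_vanishing_on X d f ->
     coordinates p v -> coordinates q w ->
     \sum_i f^`M(i).@[v 0] * w 0 i = 0].

End ProjectiveSpace.

Section Surfaces.
Context {F : fieldType}.
Implicit Types (X W H : set (proj F 3)).

Definition line X := linear_subspace 1 X.

Definition plane X := linear_subspace 2 X.

Definition quadratic_surface W := hypersurface_of_degree 2 W.

Definition smooth_surface W := forall p, W p -> plane (tangent_space W p).

Definition tangent_to W H :=
  exists p, [/\ W p, H p & tangent_space W p = H].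

End Surfaces.

(* Main.v *)
(** If [L] is spanned by [a, b] and [M] by [c, d], then
    (s a + t b) * (u c + w d) = z N, where z = (su, sw, tu, tw) is a point of the
    Segre quadric z0 z3 = z1 z2 and [N] is the matrix with rows a*c, a*d, b*c,
    b*d.  If [N] were singular, a linear form would vanish on [L * M], which is
    impossible when the ideal is generated by a quadratic form.  So [N] is
    invertible and [L * M] lies on the smooth quadric q(x N^-1) = 0.  The plane
    x_i = 0 is tangent at the product of the points of [L] and [M] with i-th
    coordinate zero: there z = (b_i d_i, - b_i c_i, - a_i d_i, a_i c_i), so that
    the gradient (z3, - z2, - z1, z0) of q is exactly the i-th column of [N]. *)
Require Import Defs.
From mathcomp Require Import all_boot all_order all_algebra.
From mathcomp Require Import classical_sets reals complex mpoly.
From mathcomp Require Import ring.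

Import GRing.Theory.

Set Implicit Arguments.
Unset Strict Implicit.
Unset Printing Implicit Defensive.

Local Open Scope ring_scope.

(** * Points, closures and hyperplanes in projective space *)

Section ProjectivePoints.
Context {F : fieldType} {n : nat}.
Implicit Types (p : proj F n) (v w : 'rV[F]_n.+1).

Lemma point_of_vector v : v != 0 -> exists p, coordinates p v /\
  forall U : {vspace 'rV[F]_n.+1}, v \in U -> (p <= U)%VS.
Proof.
move=> v0; have dv : \dim <[v]>%VS == 1%N by rewrite dim_vline v0.
exists (Proj dv); split; first by split=> //=; exact: memv_line.
by move=> U vU; rewrite /= -memvE.
Qed.

Lemma coordinates_ex p : exists v, coordinates p v.
Proof.
exists (vpick p); split; last exact: memv_pick.
by rewrite vpick0 -dimv_eq0 (eqP (proj_lineP p)).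
Qed.

Lemma line_of_coordinates p v : coordinates p v -> (p : {vspace _}) = <[v]>%VS.
Proof.
case=> v0 vp; apply/esym/eqP; rewrite eqEdim -memvE vp.
by rewrite dim_vline v0 (eqP (proj_lineP p)).
Qed.

Lemma coordinates_proportional {p v w} :
  coordinates p v -> coordinates p w -> exists c, w = c *: v.
Proof.
move=> pv [_]; rewrite (line_of_coordinates pv) => /vlineP [c ->].
by exists c.
Qed.

Lemma span_of_dim2 (U : {vspace 'rV[F]_n.+1}) : \dim U = 2 ->
  exists a b : 'rV[F]_n.+1,
    forall v, v \in U <-> exists s t, v = s *: a + t *: b.
Proof.
move=> dU; have := vbasisP U; move: (vbasis U); rewrite dU => e /andP[/eqP + _].
case/tupleP: e => a e; case/tupleP: e => b e; rewrite tuple0 /= => eU.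
exists a, b => v; rewrite -eU span_cons span_seq1; split.
- case/memv_addP => x /vlineP[s ->] [y /vlineP[t ->] ->].
  by exists s, t.
- by case=> s [t ->]; rewrite memv_add // memvZ // memv_line.
Qed.

(** The zero locus of a form is itself closed, so once it contains [X] it contains the smallest
    closed set around [X]. *)
Lemma vanishing_on_closure (X : set (proj F n)) d (f : {mpoly F[n.+1]}) :
  f \is d.-homog -> (forall p, X p -> vanishes_at f p) ->
  form_vanishing_on (zariski_closure X) d f.
Proof.
move=> fd fX; split=> // p.
have Zf : zariski_closed [set q : proj F n | vanishes_at f q].
  exists [set f]%classic; split=> [_ -> | ]; first by exists d.
  by apply/seteqP; split=> q /=; [move=> fq _ -> | exact].
by move=> /(_ _ (conj Zf fX)).
Qed.

End ProjectivePoints.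

(** Rank-nullity for the functional [w *m u]: its image lies in a space of dimension 1 and is
    nonzero, since the unit vectors are sent to the entries of [u]. *)
Lemma hyperplane_linear_subspace (F : fieldType) (n : nat) (u : 'cV[F]_n.+2) :
  u != 0 ->
  linear_subspace n
    [set p : proj F n.+1 | forall w, coordinates p w -> (w *m u) 0 0 = 0].
Proof.
move=> u0; pose f := linfun (@mulmxr F 1 n.+2 1 u).
have fE w : f w = w *m u by rewrite lfunE.
exists (lker f); split.
  have := limg_ker_dim f fullv; rewrite capfv dimvf.
  rewrite (_ : dim _ = n.+2); last exact: mul1n.
  suff -> : \dim (limg f) = 1%N by rewrite addn1 => /succn_inj.
  apply/eqP; rewrite eqn_leq; apply/andP; split.
    by rewrite (leq_trans (dimvS (subvf _))) // dimvf.
  rewrite lt0n dimv_eq0; apply: contraNneq u0 => f0.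
  apply/eqP/matrixP => i j; rewrite ord1 mxE.
  have : f (delta_mx 0 i) \in limg f by rewrite memv_img // memvf.
  by rewrite f0 memv0 fE -rowE => /eqP/matrixP/(_ 0 0); rewrite !mxE.
apply/seteqP; split=> p /=.
- move=> pu; have [v pv] := coordinates_ex p.
  rewrite (line_of_coordinates pv) -memvE memv_ker fE.
  by apply/eqP/matrixP => i j; rewrite !ord1 (pu v pv) mxE.
- move=> /subvP pU w [_ /pU]; rewrite memv_ker fE => /eqP ->.
  by rewrite mxE.
Qed.

(** * Linear forms and degrees *)

Section LinearForms.
Context {F : fieldType} {n : nat}.
Implicit Types (u v : 'I_n -> F).

Definition linear_form u : {mpoly F[n]} := \sum_i u i *: 'X_i.

Lemma linear_form_homog u : linear_form u \is 1.-homog.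
Proof.
by apply: rpred_sum => i _; apply: rpredZ; rewrite dhomogX /= mdeg1.
Qed.

Lemma meval_linear_form u v : (linear_form u).@[v] = \sum_i v i * u i.
Proof.
rewrite /linear_form raddf_sum /=; apply: eq_bigr => i _.
by rewrite mevalZ mevalXU mulrC.
Qed.

Lemma mderiv_linear_form i u : (linear_form u)^`M(i) = (u i)%:MP.
Proof.
rewrite /linear_form raddf_sum /= (bigD1 i) //= big1 => [|j ji].
  rewrite addr0 mderivZ mderivX mnm1E eqxx.
  by rewrite scale1r -[X in (X - _)%MM]add0m addmK mpolyX0 alg_mpolyC.
by rewrite mderivZ mderivX mnm1E (negPf ji) scale0r scaler0.
Qed.

Lemma linear_form_neq0 u : (exists i, u i != 0) -> linear_form u != 0.
Proof.
case=> i; apply: contraNneq => u0.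
have := mderiv_linear_form i u; rewrite u0 raddf0 => /esym/eqP.
by rewrite mpolyC_eq0.
Qed.

Lemma msize_homog d (f : {mpoly F[n]}) :
  f != 0 -> f \is d.-homog -> msize f = d.+1.
Proof.
move=> f0 fd; rewrite -(dhomog_uniq f0 (dhomog_msize fd) fd) prednK //.
by rewrite lt0n msize_poly_eq0.
Qed.

(** Degree count: [msize] is the degree plus one, so [l = h * g] would force [msize h = 0], that is
    [h = 0]. *)
Lemma quadric_not_dvd_linear_form (l g h : {mpoly F[n]}) :
  l != 0 -> l \is 1.-homog -> g \is 2.-homog -> l != h * g.
Proof.
move=> l0 l1 g2; apply/eqP => E; move: (l0).
rewrite E mulf_eq0 negb_or => /andP[h0 g0].
have := msizeM h0 g0; rewrite -E (msize_homog l0 l1) (msize_homog g0 g2).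
by rewrite addn3 /= => -[] /esym/eqP; rewrite msize_poly_eq0 (negPf h0).
Qed.

End LinearForms.

(** * Tangent spaces from one equation *)

Section TangentSpace.
Context {F : fieldType} {n : nat}.
Implicit Types (f g h Q : {mpoly F[n.+1]}) (v w : 'rV[F]_n.+1).

Lemma gradient_mul_at_zero h g v w : g.@[v 0] = 0 ->
  \sum_i (h * g)^`M(i).@[v 0] * w 0 i =
  h.@[v 0] * \sum_i g^`M(i).@[v 0] * w 0 i.
Proof.
move=> gv; rewrite mulr_sumr; apply: eq_bigr => i _.
by rewrite mderivM mevalD !mevalM gv mulr0 add0r mulrA.
Qed.

(* Writing [Q = h g], the gradient of [Q] at [p] is h(p) times that of [g]; as it
   is nonzero, so is h(p), and the two gradients have the same kernel. *)
Lemma tangent_space_of_form (X : set (proj F n)) d e g Q (p : proj F n) :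
  g \is d.-homog -> form_vanishing_on X e Q -> X p ->
  (forall k f, f \is k.-homog ->
     (form_vanishing_on X k f <-> exists h, f = h * g)) ->
  (forall v, coordinates p v ->
     exists w, \sum_i Q^`M(i).@[v 0] * w 0 i != 0) ->
  tangent_space X p = [set q | forall v w, coordinates p v -> coordinates q w ->
                         \sum_i Q^`M(i).@[v 0] * w 0 i = 0]%classic.
Proof.
move=> gd QX Xp Xg dQ.
have [_ gX] : form_vanishing_on X d g.
  by apply/Xg => //; exists 1; rewrite mul1r.
have [h Qhg] := (Xg _ _ QX.1).1 QX.
apply/seteqP; split=> q /= Tq; first by move=> v w; apply: (Tq e).
move=> k f v w fX pv qw; have gv := gX _ Xp _ pv.
have [h' ->] := (Xg _ _ fX.1).1 fX.
rewrite gradient_mul_at_zero //; have := Tq v w pv qw.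
have [w'] := dQ v pv.
rewrite Qhg !gradient_mul_at_zero // mulf_eq0 negb_or => /andP[hv _].
by move/eqP; rewrite mulf_eq0 (negPf hv) => /eqP ->; rewrite mulr0.
Qed.

End TangentSpace.

(** * The Segre quadric and its polar form *)

Section SegreQuadric.
Context {F : fieldType}.
Implicit Types (a b c d v w z y u : 'rV[F]_4) (K : 'M[F]_4).

Definition row4 (x0 x1 x2 x3 : F) : 'rV[F]_4 := \row_k [:: x0; x1; x2; x3]`_k.

Lemma sum4 (f : 'I_4 -> F) :
  \sum_i f i = f (inord 0) + f (inord 1) + f (inord 2) + f (inord 3).
Proof.
rewrite !big_ord_recl big_ord0 addr0 !addrA.
by do ![congr (_ + _)]; congr f; apply: val_inj; rewrite /= inordK.
Qed.

(** The symmetric bilinear form polar to q = z0 z3 - z1 z2: the gradient of q at [z], paired with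
    [y]. *)
Definition segre_polar z y : F :=
  z 0 (inord 3) * y 0 (inord 0) - z 0 (inord 2) * y 0 (inord 1)
  - z 0 (inord 1) * y 0 (inord 2) + z 0 (inord 0) * y 0 (inord 3).

(** This is q(x K): the k-th coordinate of x K is the linear form given by column k of [K]. *)
Definition segre_pullback K : {mpoly F[4]} :=
  let l k := linear_form (fun i => K i (inord k)) in l 0 * l 3 - l 1 * l 2.

Lemma segre_pullback_homog K : segre_pullback K \is 2.-homog.
Proof.
by apply: rpredB; apply: (@dhomogM _ _ _ 1 _ 1); apply: linear_form_homog.
Qed.

Lemma meval_segre_pullback K v (z := v *m K) : (segre_pullback K).@[v 0] =
  z 0 (inord 0) * z 0 (inord 3) - z 0 (inord 1) * z 0 (inord 2).
Proof.
by rewrite mevalB !mevalM !meval_linear_form !mxE.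
Qed.

Lemma gradient_segre_pullback K v w :
  \sum_i (segre_pullback K)^`M(i).@[v 0] * w 0 i =
  segre_polar (v *m K) (w *m K).
Proof.
have mulE (x : 'rV[F]_4) k :
  (x *m K) 0 k = \sum_i x 0 i * K i k by rewrite mxE.
(* Chain rule: row i of [K] is the image of the i-th unit vector. Linearity in the second argument
   then gives the sum over i. *)
have dE i : (segre_pullback K)^`M(i).@[v 0] = segre_polar (v *m K) (row i K).
  rewrite /segre_polar mderivB !mderivM !mderiv_linear_form.
  rewrite !(mevalB, mevalD, mevalM, mevalC) !meval_linear_form.
  by rewrite !mxE; ring.
rewrite /segre_polar !(mulE w) !mulr_sumr -!sumrB -big_split /=.
by apply: eq_bigr => i _; rewrite dE /segre_polar !mxE; ring.
Qed.

(** Up to sign the form pairs coordinate i with coordinate 3 - i, so the unit vector at [rev_ord i]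
    isolates [z 0 i]. *)
Lemma segre_polar_nondegenerate z : z != 0 -> exists y, segre_polar z y != 0.
Proof.
case/rV0Pn => i zi; exists (delta_mx 0 (rev_ord i)).
move: zi; rewrite /segre_polar !mxE -{1}(inord_val i) -!val_eqE /= !inordK //.
by case: i => -[|[|[|[|//]]]] _ /=;
  rewrite ?(mulr0, mulr1, oppr0, subr0, addr0, add0r, oppr_eq0).
Qed.

Lemma segre_polarZ k z y : segre_polar (k *: z) y = k * segre_polar z y.
Proof. by rewrite /segre_polar !mxE; ring. Qed.

Definition hadamard_rows a b c d : 'M[F]_4 :=
  \matrix_k nth 0 [:: hadamard a c; hadamard a d; hadamard b c; hadamard b d] k.

Lemma hadamard_combination a b c d (s t x y : F) :
  hadamard (s *: a + t *: b) (x *: c + y *: d) =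
  row4 (s * x) (s * y) (t * x) (t * y) *m hadamard_rows a b c d.
Proof.
apply/rowP => i; rewrite !mxE sum4 !mxE !inordK //= !mxE; ring.
Qed.

Lemma segre_polar_hadamard_rows a b c d i y :
  segre_polar (row4 (b 0 i * d 0 i) (- (b 0 i * c 0 i))
                    (- (a 0 i * d 0 i)) (a 0 i * c 0 i)) y =
  (y *m hadamard_rows a b c d) 0 i.
Proof.
by rewrite /segre_polar !mxE sum4 !mxE !inordK //= !mxE; ring.
Qed.

End SegreQuadric.

(** * The product of two lines *)

Section HadamardProductOfLines.
Context {F : fieldType}.

Lemma hadamard_product_of_lines (L M : set (proj F 3)) :
  line L -> line M -> quadratic_surface (hadamard_product L M) ->
  smooth_surface (hadamard_product L M) /\
  (forall i : 'I_4,
     tangent_to (hadamard_product L M) (coord_hyperplane i)).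
Proof.
move=> [U [/span_of_dim2 [a [b abU]] ->]] [V [/span_of_dim2 [c [d cdV]] ->]].
rewrite /hadamard_product; set P := (X in zariski_closure X).
set W := zariski_closure P => -[_ [g [g0 g2 gW]]].
pose N := hadamard_rows a b c d.
(* An arbitrary coordinate vector of [r] differs from the computed product by a scalar; it is
   absorbed into [z], as the Segre equation is homogeneous. *)
have PN r v : P r -> coordinates r v -> exists z, v = z *m N /\
    z 0 (inord 0) * z 0 (inord 3) = z 0 (inord 1) * z 0 (inord 2).
  move=> [p [q [/= /subvP pU /subvP qV [x [y [[_ /pU xU] [_ /qV yV] rxy]]]]]] rv.
  have [k ->] := coordinates_proportional rxy rv.
  have [s [t ->]] := (abU x).1 xU; have [s' [t' ->]] := (cdV y).1 yV.
  rewrite hadamard_combination scalemxAl; eexists; split; first by [].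
  by rewrite !mxE !inordK //=; ring.
have Nunit : N \in unitmx.
  (* Transposing turns the kernel vector into a column killed by [N] on the left, hence into a
     linear form vanishing on every [z *m N]. *)
  rewrite unitmxE unitfE -det_tr; apply/det0P => -[u u0 uN].
  have l0 : linear_form (u 0) != 0 by apply/linear_form_neq0/rV0Pn.
  have lW : form_vanishing_on W 1 (linear_form (u 0)).
    apply: vanishing_on_closure (linear_form_homog _) _ => r Pr v rv.
    have [z [-> _]] := PN r v Pr rv.
    have : (z *m N *m u^T) 0 0 = 0.
      by rewrite -mulmxA -[N]trmxK -trmx_mul uN trmx0 mulmx0 mxE.
    rewrite meval_linear_form [X in X = _ -> _]mxE => E.
    by rewrite -[RHS]E; apply: eq_bigr => i _; rewrite (mxE _ _ i).
  have [h /eqP] := (gW _ _ lW.1).1 lW.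
  by apply/negP/quadric_not_dvd_linear_form => //; exact: linear_form_homog.
pose K := invmx N; pose Q := segre_pullback K.
have QW : form_vanishing_on W 2 Q.
  apply: vanishing_on_closure (segre_pullback_homog _) _ => r Pr v rv.
  have [z [-> zE]] := PN r v Pr rv.
  by rewrite meval_segre_pullback mulmxK // zE subrr.
have dQ (v : 'rV[F]_4) : v != 0 ->
    exists w : 'rV[F]_4, \sum_i Q^`M(i).@[v 0] * w 0 i != 0.
  move=> v0; have [|y] := @segre_polar_nondegenerate _ (v *m K).
    by apply: contraNneq v0 => vK; rewrite -[v](mulmxKV Nunit) vK mul0mx.
  by exists (y *m N); rewrite gradient_segre_pullback (mulmxK Nunit).
(* One representative [v] is enough: rescaling it rescales the gradient of [Q]. *)
have TW p v : W p -> coordinates p v -> tangent_space W p =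
    [set q | forall w, coordinates q w ->
               \sum_i Q^`M(i).@[v 0] * w 0 i = 0]%classic.
  move=> Wp pv; rewrite (tangent_space_of_form g2 QW Wp gW) => [|x [/dQ]//].
  apply/seteqP; split=> q /= Tq; first by move=> w; apply: Tq.
  move=> x w /(coordinates_proportional pv) [k ->] /Tq.
  by rewrite !gradient_segre_pullback -scalemxAl segre_polarZ => ->;
    rewrite mulr0.
split=> [p Wp | i].
  have [v pv] := coordinates_ex p; rewrite (TW p v Wp pv).
  pose u := \col_i Q^`M(i).@[v 0].
  have uE (w : 'rV[F]_4) : (w *m u) 0 0 = \sum_i Q^`M(i).@[v 0] * w 0 i.
    by rewrite mxE; apply: eq_bigr => i _; rewrite (mxE _ _ i) mulrC.
  have u0 : u != 0.
    have [w] := dQ v pv.1; apply: contraNneq => u0.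
    by rewrite -uE u0 mulmx0 mxE.
  have := hyperplane_linear_subspace u0.
  by congr (linear_subspace 2 _); apply/seteqP; split=> q /= Tq w qw;
    have := Tq w qw; rewrite uE.
pose x := b 0 i *: a + (- a 0 i) *: b; pose y := d 0 i *: c + (- c 0 i) *: d.
pose z := row4 (b 0 i * d 0 i) (- (b 0 i * c 0 i))
               (- (a 0 i * d 0 i)) (a 0 i * c 0 i).
have xyE : hadamard x y = z *m N.
  by rewrite hadamard_combination !(mulrN, mulNr, opprK).
(* The polar of [z] against [delta_mx 0 i *m K] is the i-th coordinate of the i-th unit vector,
   namely 1. With [N] invertible this makes [z *m N] nonzero, hence also [x] and [y], so that all
   three define points. *)
have z0 : z != 0.
  apply: contraTneq (oner_neq0 F) => z0; rewrite negbK.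
  have := segre_polar_hadamard_rows a b c d i (delta_mx 0 i *m K).
  rewrite -/N -/z z0 (mulmxKV Nunit) [in RHS]mxE !eqxx.
  by rewrite -(scale0r (0 : 'rV_4)) segre_polarZ mul0r => /esym/eqP.
have xy0 : hadamard x y != 0.
  by apply: contraNneq z0 => E; rewrite -[z](mulmxK Nunit) -xyE E mul0mx.
have x0 : x != 0.
  by apply: contraNneq xy0 => ->; apply/eqP/rowP => j; rewrite !mxE mul0r.
have y0 : y != 0.
  by apply: contraNneq xy0 => ->; apply/eqP/rowP => j; rewrite !mxE mulr0.
have [r [rxy _]] := point_of_vector xy0.
have [p [px pU]] := point_of_vector x0.
have [q [qy qV]] := point_of_vector y0.
have Wr : W r.
  apply: sub_gen_smallest; exists p, q; split; last by exists x, y.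
  - by apply: pU; apply/abU; exists (b 0 i), (- a 0 i).
  - by apply: qV; apply/cdV; exists (d 0 i), (- c 0 i).
exists r; split=> //.
  move=> v /(coordinates_proportional rxy) [k ->].
  by rewrite !mxE; ring.
(* At [r] the gradient of [Q] paired with [w] is the polar of [z] with [w *m K], which equals the
   i-th coordinate of [w *m K *m N], that is [w 0 i]. *)
rewrite (TW _ _ Wr rxy); apply/seteqP; split=> s /= Ts w sw; move: (Ts w sw);
  by rewrite gradient_segre_pullback xyE mulmxK //
             segre_polar_hadamard_rows mulmxKV.
Qed.

End HadamardProductOfLines.

(* R is the field of real numbers and R[i] that of complex numbers. *)
Theorem lemma3p2 (R : realType) (L M : set (proj R[i] 3)) :
  line L -> line M ->
  quadratic_surface (hadamard_product L M) ->
  smooth_surface (hadamard_product L M) /\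
  (forall i : 'I_4,
     tangent_to (hadamard_product L M) (coord_hyperplane i)).
Proof. exact: hadamard_product_of_lines. Qed.
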